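(* Let $f:\Sigma\to\mathbb{R}^3$ be a front, $p$ a non-degenerate singular point of $f$ and $\gamma$ the singular curve passing through $p$, with singular locus $\widehat\gamma=f\circ\gamma$. (1) Suppose that $p$ is a cuspidal edge. Then $\widehat\gamma$ is a line of curvature of $f$ if and only if the cusp-directional torsion $\kappa_t$ vanishes identically along $\gamma$. (2) Suppose that $p$ is of the second kind. Then $\widehat\gamma$ cannot be a line of curvature.
   Context: All maps are $C^\infty$. $\Sigma\subset\mathbb{R}^2$ is a domain. A map $f:\Sigma\to\mathbb{R}^3$ is a frontal if there is a unit normal vector $\nu:\Sigma\to S^2$ (orthogonal to the image of $df$ everywhere); it is a front if moreover $(f,\nu):\Sigma\to\mathbb{R}^3\times S^2$ is an immersion. $S(f)$ is the set of points where $f$ is not an immersion. The signed area density is $\lambda=\det(f_u,f_v,\nu)$, so $S(f)=\lambda^{-1}(0)$. A point $p\in S(f)$ is non-degenerate if $d\lambda(p)\ne0$; then near $p$, $S(f)$ is a regular curve $\gamma$ (the singular curve, $\gamma(0)=p$), and there is a non-vanishing vector field $\eta$ (null vector field) with $df(\eta)=0$ along $\gamma$. A non-degenerate singular point $p$ is of the first kind if $\eta$ is transverse to $\gamma'$ at $p$, otherwise of the second kind. A cuspidal edge is a point where the germ of $f$ is $\mathcal{A}$-equivalent to $(u,v)\mapsto(u,v^2,v^3)$ at $0$; for fronts this is the same as a non-degenerate singular point of the first kind. Everything is considered near $p$. Adapted coordinates. A coordinate system $(U;u,v)$ centered at $p$, compatible with the orientation of $\Sigma$, is adapted if the $u$-axis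 is the singular curve, there are no singular points off the $u$-axis, and on the $u$-axis the null vector field is $\eta=\partial_v$ (first kind), respectively $\eta=\partial_u+\epsilon(u)\partial_v$ with $\epsilon(0)=0$ (second kind). $U$ is taken small. Cuspidal edge. There is $\varphi:U\to\mathbb{R}^3\setminus\{0\}$ with $f_v=v\varphi$. Put $\widetilde E=\|f_u\|^2$, $\widetilde F=\langle f_u,\varphi\rangle$, $\widetilde G=\|\varphi\|^2$, $\widetilde L=-\langle f_u,\nu_u\rangle$, $\widetilde M=-\langle\varphi,\nu_u\rangle$, $\widetilde N=-\langle\varphi,\nu_v\rangle$, $D=\widetilde E\widetilde G-\widetilde F^2$, $\widetilde A=\widetilde E\widetilde N-2v\widetilde F\widetilde M+v\widetilde G\widetilde L$, $\widetilde B=\sqrt{\widetilde A^2-4vD(\widetilde L\widetilde N-v\widetilde M^2)}$. The principal curvatures on $U\setminus\{v=0\}$ are $\kappa_\pm=\dfrac{2(\widetilde L\widetilde N-v\widetilde M^2)}{\widetilde A\pm\widetilde B}=\dfrac{\widetilde A\mp\widetilde B}{2vD}$. Exactly one of them extends to a bounded $C^\infty$-function near $p$; call it $\kappa$. The principal vector (field) with respect to $\kappa$ is $\bm{v}=(\widetilde N-v\kappa\widetilde G)\,\partial_u+(-\widetilde M+\kappa\widetilde F)\,\partial_v$. The cusp-directional torsion along the $u$-axis is $$\kappa_t=\frac{\det(f_u,\varphi,f_{uvv})}{\|f_u\times\varphi\|^2}-\frac{\det(f_u,\varphi,f_{uu})\langle f_u,\varphi\rangle}{\|f_u\|^2\|f_u\times\varphi\|^2}.$$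 Second kind. There is $\varphi:U\to\mathbb{R}^3\setminus\{0\}$ with $f_u+\epsilon(u)f_v=v\varphi$. Put $\widehat E=\|\varphi\|^2$, $\widehat F=\langle\varphi,f_v\rangle$, $\widehat G=\|f_v\|^2$, $\widehat L=-\langle\varphi,\nu_u\rangle$, $\widehat M=-\langle\varphi,\nu_v\rangle$, $\widehat N=-\langle f_v,\nu_v\rangle$, $\widehat D=\widehat E\widehat G-\widehat F^2$, $\widehat Q=(\widehat L+\epsilon\widehat M)\widehat N-v\widehat M^2$, $\widehat A=\widehat G(\widehat L+\epsilon\widehat M)-2v\widehat F\widehat M+v\widehat E\widehat N$, $\widehat B=\sqrt{\widehat A^2-4v\widehat D\widehat Q}$. The principal curvatures on $U\setminus\{v=0\}$ are $\kappa_\pm=\dfrac{2\widehat Q}{\widehat A\pm\widehat B}=\dfrac{\widehat A\mp\widehat B}{2v\widehat D}$. Exactly one of them extends to a bounded $C^\infty$-function near $p$; call it $\kappa$. The principal vector (field) with respect to $\kappa$ is $\bm{v}=(-\widehat M+\kappa\widehat F)\,\partial_u+\big(\widehat L-\kappa(v\widehat E-\epsilon\widehat F)\big)\,\partial_v$. In both cases $\bm v$ is a non-vanishing solution of $(II-\kappa I)\bm v=0$ off the singular set, where $I$, $II$ are the first and second fundamental matrices. The singular locus $\widehat\gamma=f\circ\gamma$ is called a line of curvature if the principal vector $\bm v$ is tangent to $\gamma$ (at every point of $\gamma$ near $p$). *)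

(* Defs.v *)
From HB Require Import structures.
From mathcomp Require Import all_boot all_order all_algebra.
From mathcomp Require Import all_classical all_reals all_analysis.
Set Implicit Arguments.
Unset Strict Implicit.
Unset Printing Implicit Defensive.
Import Order.TTheory GRing.Theory Num.Theory.
Import numFieldNormedType.Exports.
Local Open Scope classical_set_scope.
Local Open Scope ring_scope.

(* For finite-dimensional [V] and open [A] this is the usual C^k condition:
   a map is C^(k+1) when it is differentiable and all its directional
   derivatives are C^k. *)
Fixpoint Ck_on (R : realType) (V W : normedModType R) (k : nat)
    (A : set V) (h : V -> W) : Prop :=
  match k with
  | 0 => forall x, A x -> {for x, continuous h}
  | k'.+1 => (forall x, A x -> differentiable h x) /\
             (forall w : V, Ck_on k' A ('D_w h))
  end.

Definition smooth_on (R : realType) (V W : normedModType R)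
    (A : set V) (h : V -> W) : Prop := forall k, Ck_on k A h.

Definition smooth_near (R : realType) (V W : normedModType R)
    (x : V) (h : V -> W) : Prop := exists2 A, open_nbhs x A & smooth_on A h.

Definition germ_diffeo (R : realType) (V W : normedModType R)
    (x : V) (y : W) (h : V -> W) : Prop :=
  [/\ h x = y, smooth_near x h &
      exists k : W -> V, [/\ smooth_near y k,
        \forall z \near x, k (h z) = z & \forall z \near y, h (k z) = z]].

(* The library norm on row vectors is the sup norm; Euclidean lengths are
   expressed through [dot]. *)
Definition dot (R : realType) (a b : 'rV[R]_3) : R :=
  \sum_(i < 3) a 0 i * b 0 i.

Definition normsq (R : realType) (a : 'rV[R]_3) : R := dot a a.

Definition det3 (R : realType) (a b c : 'rV[R]_3) : R :=
  \det (col_mx a (col_mx b c) : 'M[R]_3).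

Definition cross (R : realType) (a b : 'rV[R]_3) : 'rV[R]_3 :=
  \row_(k < 3) det3 (delta_mx 0 k) a b.

(* Points of the plane are row vectors [(u, v)]. *)
Definition ucoord (R : realType) (x : 'rV[R]_2) : R := x 0 0.
Definition vcoord (R : realType) (x : 'rV[R]_2) : R := x 0 1.

Definition vec2 (R : realType) (a b : R) : 'rV[R]_2 :=
  \row_(i < 2) (if i == 0 then a else b).
Definition vec3 (R : realType) (a b c : R) : 'rV[R]_3 :=
  \row_(i < 3) (if i == 0 then a else if i == 1 then b else c).

Definition du (R : realType) (W : normedModType R) (h : 'rV[R]_2 -> W) :
  'rV[R]_2 -> W := 'D_(vec2 1 0) h.
Definition dv (R : realType) (W : normedModType R) (h : 'rV[R]_2 -> W) :
  'rV[R]_2 -> W := 'D_(vec2 0 1) h.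

Definition planar_domain (R : realType) (Sigma : set 'rV[R]_2) : Prop :=
  [/\ open Sigma, connected Sigma & Sigma !=set0].

Definition immersion_at (R : realType) (V W : normedModType R)
    (h : V -> W) (q : V) : Prop := injective ('d h q).

Definition unit_normal (R : realType) (Sigma : set 'rV[R]_2)
    (f nu : 'rV[R]_2 -> 'rV[R]_3) : Prop :=
  [/\ smooth_on Sigma nu,
      forall q, Sigma q -> normsq (nu q) = 1 &
      forall q w, Sigma q -> dot ('d f q w) (nu q) = 0].

Definition front (R : realType) (Sigma : set 'rV[R]_2)
    (f nu : 'rV[R]_2 -> 'rV[R]_3) : Prop :=
  [/\ smooth_on Sigma f, unit_normal Sigma f nu &
      forall q, Sigma q -> immersion_at (fun x => (f x, nu x)) q].

Definition singular_set (R : realType) (Sigma : set 'rV[R]_2)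
    (f : 'rV[R]_2 -> 'rV[R]_3) : set 'rV[R]_2 :=
  [set q | Sigma q /\ ~ immersion_at f q].

Definition signed_area_density (R : realType) (f nu : 'rV[R]_2 -> 'rV[R]_3)
    (q : 'rV[R]_2) : R := det3 (du f q) (dv f q) (nu q).

Definition nondegenerate_singular (R : realType) (Sigma : set 'rV[R]_2)
    (f nu : 'rV[R]_2 -> 'rV[R]_3) (p : 'rV[R]_2) : Prop :=
  singular_set Sigma f p /\
  exists w, 'd (signed_area_density f nu) p w != 0.

Definition singular_curve (R : realType) (Sigma : set 'rV[R]_2)
    (f : 'rV[R]_2 -> 'rV[R]_3) (p : 'rV[R]_2) (gam : R -> 'rV[R]_2) : Prop :=
  gam 0 = p /\
  exists2 e : R, 0 < e &
    [/\ smooth_on [set t | `|t| < e] (gam : R^o -> 'rV[R]_2),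
        forall t, `|t| < e -> derive1 gam t != 0 &
        exists2 W : set 'rV[R]_2, open_nbhs p W &
          singular_set Sigma f `&` W = gam @` [set t | `|t| < e]].

Definition null_vector_field (R : realType) (f : 'rV[R]_2 -> 'rV[R]_3)
    (gam eta : R -> 'rV[R]_2) : Prop :=
  smooth_near (0 : R^o) (eta : R^o -> 'rV[R]_2) /\
  \forall t \near (0 : R), eta t != 0 /\ 'd f (gam t) (eta t) = 0.

Definition tangent_to (R : realType) (w d : 'rV[R]_2) : Prop :=
  exists c : R, w = c *: d.

Definition first_kind (R : realType) (Sigma : set 'rV[R]_2)
    (f nu : 'rV[R]_2 -> 'rV[R]_3) (p : 'rV[R]_2) (gam : R -> 'rV[R]_2) : Prop :=
  nondegenerate_singular Sigma f nu p /\
  exists2 eta, null_vector_field f gam eta & ~ tangent_to (eta 0) (derive1 gam 0).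

Definition second_kind (R : realType) (Sigma : set 'rV[R]_2)
    (f nu : 'rV[R]_2 -> 'rV[R]_3) (p : 'rV[R]_2) (gam : R -> 'rV[R]_2) : Prop :=
  nondegenerate_singular Sigma f nu p /\ ~ first_kind Sigma f nu p gam.

Definition cuspidal_edge (R : realType) (f : 'rV[R]_2 -> 'rV[R]_3)
    (p : 'rV[R]_2) : Prop :=
  exists (a : 'rV[R]_2 -> 'rV[R]_2) (b : 'rV[R]_3 -> 'rV[R]_3),
    [/\ germ_diffeo 0 p a, germ_diffeo (f p) 0 b &
        \forall x \near (0 : 'rV[R]_2),
          b (f (a x)) = vec3 (ucoord x) (vcoord x ^+ 2) (vcoord x ^+ 3)].

(* A coordinate system centered at [p]: [X] maps an open set [U] containing [p]
   to the coordinates, which range over [V]; [Y] is its inverse. Geometric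
   objects are computed in the coordinates as functions on [V], from
   [f \o Y] and [nu \o Y]. *)
Definition oriented_chart (R : realType) (Sigma : set 'rV[R]_2)
    (p : 'rV[R]_2) (U V : set 'rV[R]_2) (X Y : 'rV[R]_2 -> 'rV[R]_2) : Prop :=
  [/\ [/\ open_nbhs p U, U `<=` Sigma, open V & X p = 0],
      smooth_on U X /\ smooth_on V Y,
      forall q, U q -> V (X q) /\ Y (X q) = q,
      forall x, V x -> U (Y x) /\ X (Y x) = x &
      forall x, V x -> 0 < \det ('J Y x)].

Definition singular_on_u_axis (R : realType) (Sigma : set 'rV[R]_2)
    (f : 'rV[R]_2 -> 'rV[R]_3) (V : set 'rV[R]_2)
    (Y : 'rV[R]_2 -> 'rV[R]_2) : Prop :=
  forall x, V x -> singular_set Sigma f (Y x) <-> vcoord x = 0.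

Definition adapted_first (R : realType) (Sigma : set 'rV[R]_2)
    (f : 'rV[R]_2 -> 'rV[R]_3) (p : 'rV[R]_2) (U V : set 'rV[R]_2)
    (X Y : 'rV[R]_2 -> 'rV[R]_2) : Prop :=
  [/\ oriented_chart Sigma p U V X Y, singular_on_u_axis Sigma f V Y &
      forall x, V x -> vcoord x = 0 -> dv (f \o Y) x = 0].

Definition adapted_second (R : realType) (Sigma : set 'rV[R]_2)
    (f : 'rV[R]_2 -> 'rV[R]_3) (p : 'rV[R]_2) (U V : set 'rV[R]_2)
    (X Y : 'rV[R]_2 -> 'rV[R]_2) (eps : R -> R) : Prop :=
  [/\ oriented_chart Sigma p U V X Y, singular_on_u_axis Sigma f V Y,
      smooth_on (@ucoord R @` V : set R^o) (eps : R^o -> R^o), eps 0 = 0 &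
      forall x, V x -> vcoord x = 0 ->
        du (f \o Y) x + eps (ucoord x) *: dv (f \o Y) x = 0].

Definition phi_first (R : realType) (V : set 'rV[R]_2)
    (g phi : 'rV[R]_2 -> 'rV[R]_3) : Prop :=
  [/\ smooth_on V phi, forall x, V x -> phi x != 0 &
      forall x, V x -> dv g x = vcoord x *: phi x].

Definition phi_second (R : realType) (V : set 'rV[R]_2) (eps : R -> R)
    (g phi : 'rV[R]_2 -> 'rV[R]_3) : Prop :=
  [/\ smooth_on V phi, forall x, V x -> phi x != 0 &
      forall x, V x ->
        du g x + eps (ucoord x) *: dv g x = vcoord x *: phi x].

(* In the following two modules, [g] and [n] are the front and its unit normal
   read in an adapted coordinate system. The principal curvatures are given by
   the formula whose denominator [2 v D] does not vanish off the u-axis. *)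
Module FirstKind.

Definition E (R : realType) (g : 'rV[R]_2 -> 'rV[R]_3) x : R :=
  normsq (du g x).
Definition F (R : realType) (g phi : 'rV[R]_2 -> 'rV[R]_3) x : R :=
  dot (du g x) (phi x).
Definition G (R : realType) (phi : 'rV[R]_2 -> 'rV[R]_3) x : R :=
  normsq (phi x).
Definition L (R : realType) (g n : 'rV[R]_2 -> 'rV[R]_3) x : R :=
  - dot (du g x) (du n x).
Definition M (R : realType) (n phi : 'rV[R]_2 -> 'rV[R]_3) x : R :=
  - dot (phi x) (du n x).
Definition N (R : realType) (n phi : 'rV[R]_2 -> 'rV[R]_3) x : R :=
  - dot (phi x) (dv n x).
Definition D (R : realType) (g phi : 'rV[R]_2 -> 'rV[R]_3) x : R :=
  E g x * G phi x - F g phi x ^+ 2.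
Definition A (R : realType) (g n phi : 'rV[R]_2 -> 'rV[R]_3) x : R :=
  E g x * N n phi x - 2 * vcoord x * F g phi x * M n phi x
  + vcoord x * G phi x * L g n x.
Definition B (R : realType) (g n phi : 'rV[R]_2 -> 'rV[R]_3) x : R :=
  Num.sqrt (A g n phi x ^+ 2 - 4 * vcoord x * D g phi x
    * (L g n x * N n phi x - vcoord x * M n phi x ^+ 2)).

Definition kappa_plus (R : realType) (g n phi : 'rV[R]_2 -> 'rV[R]_3) x : R :=
  (A g n phi x - B g n phi x) / (2 * vcoord x * D g phi x).
Definition kappa_minus (R : realType) (g n phi : 'rV[R]_2 -> 'rV[R]_3) x : R :=
  (A g n phi x + B g n phi x) / (2 * vcoord x * D g phi x).

Definition principal_vector (R : realType) (g n phi : 'rV[R]_2 -> 'rV[R]_3)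
    (kappa : 'rV[R]_2 -> R) x : 'rV[R]_2 :=
  vec2 (N n phi x - vcoord x * kappa x * G phi x)
       (- M n phi x + kappa x * F g phi x).

Definition cusp_directional_torsion (R : realType)
    (g phi : 'rV[R]_2 -> 'rV[R]_3) x : R :=
  det3 (du g x) (phi x) (dv (dv (du g)) x) / normsq (cross (du g x) (phi x))
  - det3 (du g x) (phi x) (du (du g) x) * dot (du g x) (phi x)
    / (normsq (du g x) * normsq (cross (du g x) (phi x))).

End FirstKind.

Module SecondKind.

Definition E (R : realType) (phi : 'rV[R]_2 -> 'rV[R]_3) x : R :=
  normsq (phi x).
Definition F (R : realType) (g phi : 'rV[R]_2 -> 'rV[R]_3) x : R :=
  dot (phi x) (dv g x).
Definition G (R : realType) (g : 'rV[R]_2 -> 'rV[R]_3) x : R :=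
  normsq (dv g x).
Definition L (R : realType) (n phi : 'rV[R]_2 -> 'rV[R]_3) x : R :=
  - dot (phi x) (du n x).
Definition M (R : realType) (n phi : 'rV[R]_2 -> 'rV[R]_3) x : R :=
  - dot (phi x) (dv n x).
Definition N (R : realType) (g n : 'rV[R]_2 -> 'rV[R]_3) x : R :=
  - dot (dv g x) (dv n x).
Definition D (R : realType) (g phi : 'rV[R]_2 -> 'rV[R]_3) x : R :=
  E phi x * G g x - F g phi x ^+ 2.
Definition Q (R : realType) (eps : R -> R) (g n phi : 'rV[R]_2 -> 'rV[R]_3)
    x : R :=
  (L n phi x + eps (ucoord x) * M n phi x) * N g n x
  - vcoord x * M n phi x ^+ 2.
Definition A (R : realType) (eps : R -> R) (g n phi : 'rV[R]_2 -> 'rV[R]_3)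
    x : R :=
  G g x * (L n phi x + eps (ucoord x) * M n phi x)
  - 2 * vcoord x * F g phi x * M n phi x + vcoord x * E phi x * N g n x.
Definition B (R : realType) (eps : R -> R) (g n phi : 'rV[R]_2 -> 'rV[R]_3)
    x : R :=
  Num.sqrt (A eps g n phi x ^+ 2
            - 4 * vcoord x * D g phi x * Q eps g n phi x).

Definition kappa_plus (R : realType) (eps : R -> R)
    (g n phi : 'rV[R]_2 -> 'rV[R]_3) x : R :=
  (A eps g n phi x - B eps g n phi x) / (2 * vcoord x * D g phi x).
Definition kappa_minus (R : realType) (eps : R -> R)
    (g n phi : 'rV[R]_2 -> 'rV[R]_3) x : R :=
  (A eps g n phi x + B eps g n phi x) / (2 * vcoord x * D g phi x).

Definition principal_vector (R : realType) (eps : R -> R)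
    (g n phi : 'rV[R]_2 -> 'rV[R]_3) (kappa : 'rV[R]_2 -> R) x : 'rV[R]_2 :=
  vec2 (- M n phi x + kappa x * F g phi x)
       (L n phi x
        - kappa x * (vcoord x * E phi x - eps (ucoord x) * F g phi x)).

End SecondKind.

(* Off the u-axis [kappa] is one of the two principal curvatures, with the same
   choice on both sides; smoothness at [0] includes local boundedness. *)
Definition bounded_principal_curvature (R : realType)
    (kplus kminus kappa : 'rV[R]_2 -> R) : Prop :=
  smooth_near 0 (kappa : 'rV[R]_2 -> R^o) /\
  ((\forall x \near (0 : 'rV[R]_2), vcoord x != 0 -> kappa x = kplus x) \/
   (\forall x \near (0 : 'rV[R]_2), vcoord x != 0 -> kappa x = kminus x)).

(* [pv] is a vector field in the coordinates, so that ['d Y] sends it to the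
   corresponding tangent vector of the plane domain containing [gam]. *)
Definition line_of_curvature (R : realType) (gam : R -> 'rV[R]_2)
    (X Y pv : 'rV[R]_2 -> 'rV[R]_2) : Prop :=
  \forall t \near (0 : R),
    tangent_to ('d Y (X (gam t)) (pv (X (gam t)))) (derive1 gam t).

(* Main.v *)
Require Import Defs.
From mathcomp Require Import all_boot all_order all_algebra.
From mathcomp Require Import all_classical all_reals all_analysis.
From mathcomp Require Import ring lra.
Set Implicit Arguments.
Unset Strict Implicit.
Unset Printing Implicit Defensive.
Import Order.TTheory GRing.Theory Num.Theory.
Import numFieldNormedType.Exports.
Local Open Scope classical_set_scope.
Local Open Scope ring_scope.

(* In the chart, write g for the front and n for its normal. Non-degeneracy says
   that (g_u, phi, n), respectively (phi, g_v, n), is a basis at the origin.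

   First kind: on the u-axis the bounded curvature is the root of
   v D k^2 - A k + Q = 0 that survives at v = 0, so k = L/E, and the principal
   vector is tangent to the axis iff E M = L F. There g_uvv = phi_u, because
   g_uv = v phi_u, and <phi_u, n> = M, <g_uu, n> = L; as g_u x phi = c n, the
   torsion is c^-1 (M - L F / E).

   Second kind: the second component of the principal vector at the origin is
   L. It does not vanish: g_u = 0 there, so n_u <> 0 is orthogonal to n and, by
   symmetry of the second fundamental form, to g_v. *)

(** * Symmetry of mixed partial derivatives *)

Lemma derive_along_line (R : realType) (V : normedModType R) (h : V -> R)
    (y a : V) (t : R) :
  differentiable h (t *: a + y) ->
  is_derive t 1 (fun s : R => h (s *: a + y)) ('D_a h (t *: a + y)).
Proof.
move=> dh; have -> : (fun s : R => h (s *: a + y)) = h \o (shift y \o *:%R^~ a) by [].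
have [dsc vsc] := is_diff_scalel t a.
have dsh : is_diff t (shift y \o *:%R^~ a) ( *:%R^~ a).
  by apply: is_diff_eq; rewrite addr0.
have dc := @is_diff_comp _ _ _ _ _ _ _ _ _ dsh (differentiableP dh).
split; first exact/derivable1_diffP/ex_diff.
rewrite deriveE; last exact: ex_diff.
by rewrite diff_val /= scale1r deriveE.
Qed.

(** The mean value theorem in the direction [a], applied to the increment of [h] by [s *: b], turns
    the second difference into [s] times a difference of two values of ['D_a h]. Expanding both to
    first order at [x] leaves [s ^+ 2 * 'D_b ('D_a h) x]. *)
Lemma second_difference_approx (R : realType) (V : normedModType R)
    (h : V -> R) (x a b : V) :
  (\forall y \near x, differentiable h y) -> differentiable ('D_a h) x ->
  forall e : R, 0 < e -> \forall s \near (0 : R)^'+,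
    `|h (x + s *: a + s *: b) - h (x + s *: a) - h (x + s *: b) + h x
      - s ^+ 2 * 'D_b ('D_a h) x| <= e * s ^+ 2.
Proof.
move=> hdiff adiff e e0.
have [/= d1 d1_gt0 hd] := (nbhs_ballP _ _).1 hdiff.
(* The two expansion errors are at most [e / C] times c|a| + s|b| and c|a|, with c < s, so their sum
   stays below [e * s]. The summand 1 keeps [C] positive even if [a] and [b] vanish. *)
set C := 1 + 2 * `|a| + `|b|.
have C0 : 0 < C by rewrite /C; have := normr_ge0 a; have := normr_ge0 b; lra.
have /eqaddoP/(_ (e / C)) := diff_locally adiff.
rewrite divr_gt0// => /(_ isT) /nbhs_ballP [/= d2 d2_gt0 ad].
near=> s.
have s0 : 0 < s by near: s; exact: nbhs_right_gt.
have sC : s * C < Num.min d1 d2.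
  rewrite -ltr_pdivlMr//; near: s; apply: nbhs_right_lt.
  by rewrite divr_gt0// lt_min d1_gt0.
have small (c u : R) : 0 <= c <= s -> 0 <= u <= s ->
    `|c *: a + u *: b| <= s * C /\ `|c *: a + u *: b| <= c * `|a| + u * `|b|.
  move=> /andP[c0 cs] /andP[u0 us].
  have le1 : `|c *: a + u *: b| <= c * `|a| + u * `|b|.
    by rewrite (le_trans (ler_normD _ _))// !normrZ !ger0_norm.
  split=> //; apply: (le_trans le1); rewrite /C.
  have := normr_ge0 a; have := normr_ge0 b; nra.
have hdiff' (c u : R) : 0 <= c <= s -> 0 <= u <= s -> differentiable h (c *: a + (u *: b + x)).
  move=> cs us; apply: hd; rewrite -ball_normE /= addrA opprD addrCA subrr addr0 normrN.
  by apply: le_lt_trans (small _ _ cs us).1 _; apply: lt_le_trans sC _; rewrite ge_min lexx.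
have adiff' (c u : R) : 0 <= c <= s -> 0 <= u <= s ->
   `|'D_a h (c *: a + (u *: b + x)) - 'D_a h x - 'd ('D_a h) x (c *: a + u *: b)|
    <= e / C * (c * `|a| + u * `|b|).
  move=> cs us; have /(_ (c *: a + u *: b)) := ad.
  rewrite -ball_normE /= sub0r normrN => /(_ (le_lt_trans (small _ _ cs us).1 (lt_le_trans sC _))).
  rewrite ge_min lexx orbT => /(_ isT).
  rewrite /= /shift /= !fctE addrA opprD addrA => /le_trans; apply.
  by rewrite ler_wpM2l ?(small _ _ cs us).2// divr_ge0// ltW.
(* The term [0 *: b] gives both summands the same shape, so that [hdiff'] and [adiff'] apply to
   each. *)
pose ph := (fun t : R => h (t *: a + (s *: b + x))) - (fun t => h (t *: a + (0 *: b + x))).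
pose dph t := 'D_a h (t *: a + (s *: b + x)) - 'D_a h (t *: a + (0 *: b + x)).
have phd t : 0 <= t <= s -> is_derive t 1 ph (dph t).
  move=> ts; apply: is_deriveB; apply: derive_along_line; apply: hdiff' => //.
  - by rewrite lexx ltW.
  - by rewrite lexx ltW.
have [c] : exists2 c, c \in `]0, s[%R & ph s - ph 0 = dph c * (s - 0).
  apply: MVT => //.
    by move=> t; rewrite in_itv /= => /andP[t0 ts]; apply: phd; rewrite !ltW.
  apply: derivable_within_continuous => t; rewrite in_itv /= => ts.
  by have [] := phd t ts.
rewrite in_itv /= subr0 => /andP[c0 cs] phE.
have cI : 0 <= c <= s by rewrite !ltW.
have sI : 0 <= s <= s by rewrite lexx ltW.
have zI : 0 <= (0 : R) <= s by rewrite lexx ltW.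
have -> : h (x + s *: a + s *: b) - h (x + s *: a) - h (x + s *: b) + h x = s * dph c.
  rewrite [RHS]mulrC -phE /ph !fctE !scale0r !add0r.
  rewrite [s *: a + (_ + _)]addrC [s *: b + x]addrC [s *: a + x]addrC.
  by rewrite [x + s *: b + s *: a]addrAC; ring.
have B1 := adiff' _ _ cI sI; rewrite linearD !linearZ /= -(deriveE b adiff) in B1.
have B2 := adiff' _ _ cI zI; rewrite scale0r add0r mul0r !addr0 linearZ /= in B2.
move: B1 B2; rewrite /dph scale0r add0r.
set u := 'D_a h (c *: a + x); set w := 'D_a h x; set v := 'D_a h (_ + _).
set z := 'd _ _ _; set q := 'D_b _ _ => B1 B2.
(* The term [c *: z], which depends on the unknown intermediate point, occurs in both expansions and
   cancels. *)
have -> : s * (v - u) - s ^+ 2 * q = s * ((v - w - (c *: z + s *: q)) - (u - w - c *: z)).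
  by rewrite /GRing.scale /=; ring.
rewrite normrM (gtr0_norm s0) expr2 mulrCA ler_pM2l//.
apply: le_trans (ler_normB _ _) _; apply: le_trans (lerD B1 B2) _.
rewrite -mulrDr mulrAC -mulrA ler_pM2l // ler_pdivrMr // /C.
have := normr_ge0 a; have := normr_ge0 b; nra.
Unshelve. all: by end_near. Qed.

(** The second difference is symmetric in [a] and [b], so for one small [s > 0] both mixed
    derivatives, multiplied by [s ^+ 2], lie within [e / 2 * s ^+ 2] of the same number. *)
Lemma derive_derive_comm (R : realType) (V : normedModType R)
    (h : V -> R) (x a b : V) :
  (\forall y \near x, differentiable h y) ->
  differentiable ('D_a h) x -> differentiable ('D_b h) x ->
  'D_a ('D_b h) x = 'D_b ('D_a h) x.
Proof.
move=> hd ad bd; apply/eqP; rewrite -subr_eq0 -normr_le0.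
apply/ler_addgt0Pr => e e0; rewrite add0r.
have e2 : 0 < e / 2 by rewrite divr_gt0.
have A1 := second_difference_approx b hd ad e2.
have A2 := second_difference_approx a hd bd e2.
have [s [B1 [B2 s0]]] := filter_ex (filterI A1 (filterI A2 (nbhs_right_gt 0))).
rewrite [x + s *: b + _]addrAC [h _ - h _ - h _]addrAC in B2.
rewrite -(ler_pM2l (exprn_gt0 2 s0)) -{1}[s ^+ 2]gtr0_norm ?exprn_gt0// -normrM.
rewrite [leRHS](_ : _ = e / 2 * s ^+ 2 + e / 2 * s ^+ 2); last by field.
apply: le_trans (lerD B1 B2).
set u := h _ - _ - _ + _; set p := 'D_a _ _; set q := 'D_b _ _.
have -> : s ^+ 2 * (p - q) = u - s ^+ 2 * q - (u - s ^+ 2 * p) by ring.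
exact: ler_normB.
Qed.

(** * Differentiability as a germ property, and coordinatewise calculus of vector-valued maps *)

Lemma near_eq_differentiable (R : realType) (V W : normedModType R)
    (h k : V -> W) (x : V) :
  (\forall y \near x, h y = k y) -> differentiable h x -> differentiable k x.
Proof.
move=> hk dh; have [dc dE] := (diff_locallyP _ _).1 dh.
have kE : k \o shift x = cst (k x) + 'd h x +o_ 0 id.
  apply/eqaddoP => e e0; move/eqaddoP : dE => /(_ e e0) dE.
  have hk0 : \forall y \near 0, h (y + x) = k (y + x).
    by move: hk; rewrite (near_shift 0) subr0.
  rewrite -(nbhs_singleton hk).
  by apply: filterS2 hk0 dE => y hky; rewrite /= !fctE /= -hky.
have dkE : 'd k x = 'd h x :> (V -> W) by exact: diff_unique.
by apply/diff_locallyP; rewrite dkE.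
Qed.

Lemma coord_differentiable (R : realType) (V : normedModType R) m n
    (h : V -> 'M[R]_(m, n)) (x : V) i j :
  differentiable h x -> differentiable (fun y => h y i j) x.
Proof.
move=> dh; apply: (@differentiable_comp _ _ _ _ h (fun M : 'M[R]_(m, n) => M i j)) => //.
exact: differentiable_coord.
Qed.

Lemma derive_coord (R : realType) (V : normedModType R) m n
    (h : V -> 'M[R]_(m, n)) (x v : V) i j :
  differentiable h x -> 'D_v (fun y => h y i j) x = 'D_v h x i j.
Proof. by move=> dh; rewrite (derive_mx (diff_derivable dh)) mxE. Qed.

Lemma row_differentiable (R : realType) (V : normedModType R) n
    (h : V -> 'rV[R]_n) (x : V) :
  (forall j, differentiable (fun y => h y 0 j) x) -> differentiable h x.
Proof.
move=> dh; have -> : h = \sum_(j < n) (fun y => h y 0 j *: delta_mx 0 j).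
  by apply/funext => y; rewrite [LHS]row_sum_delta fct_sumE.
by apply: differentiable_sum => j; apply: differentiableZl.
Qed.

Lemma scale_differentiable (R : realType) (V : normedModType R) n
    (k : V -> R) (h : V -> 'rV[R]_n) (x : V) :
  differentiable k x -> differentiable h x ->
  differentiable (fun y => k y *: h y) x.
Proof.
move=> dk dh; apply: row_differentiable => j.
have -> : (fun y => (k y *: h y) 0 j) = k * (fun y => h y 0 j).
  by apply/funext => y; rewrite mxE.
by apply: differentiableM => //; exact: coord_differentiable.
Qed.

Lemma derive_scale (R : realType) (V : normedModType R) n
    (k : V -> R) (h : V -> 'rV[R]_n) (x v : V) :
  differentiable k x -> differentiable h x ->
  'D_v (fun y => k y *: h y) x = 'D_v k x *: h x + k x *: 'D_v h x.
Proof.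
move=> dk dh; apply/rowP => j.
rewrite -derive_coord; last exact: scale_differentiable.
have -> : (fun y => (k y *: h y) 0 j) = k * (fun y => h y 0 j).
  by apply/funext => y; rewrite mxE.
have dj := coord_differentiable 0 j dh.
rewrite deriveM; [|exact: diff_derivable..].
by rewrite derive_coord// !mxE addrC; congr (_ + _); rewrite [LHS]mulrC.
Qed.

Lemma derive_derive_comm_row (R : realType) (V : normedModType R) n
    (h : V -> 'rV[R]_n) (x a b : V) :
  (\forall y \near x, differentiable h y) ->
  differentiable ('D_a h) x -> differentiable ('D_b h) x ->
  'D_a ('D_b h) x = 'D_b ('D_a h) x.
Proof.
move=> dh da db; apply/rowP => j.
apply: etrans (esym (derive_coord a 0 j db)) _; apply: etrans (derive_coord b 0 j da).
have E v : \forall y \near x, ('D_v h y) 0 j = 'D_v (fun y => h y 0 j) y.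
  by apply: filterS dh => y dy; rewrite derive_coord.
rewrite (near_eq_derive _ (E a)) (near_eq_derive _ (E b)).
apply: derive_derive_comm.
- by apply: filterS dh => y dy; exact: coord_differentiable.
- exact: near_eq_differentiable (E a) (coord_differentiable _ _ da).
- exact: near_eq_differentiable (E b) (coord_differentiable _ _ db).
Qed.

(** * Algebra and calculus of the triple product *)

Lemma det_mx3 (R : comNzRingType) (M : 'M[R]_3) :
  \det M = M 0 0 * (M 1 1 * M 2 2 - M 1 2 * M 2 1)
         - M 0 1 * (M 1 0 * M 2 2 - M 1 2 * M 2 0)
         + M 0 2 * (M 1 0 * M 2 1 - M 1 1 * M 2 0).
Proof.
rewrite (expand_det_row _ 0) !big_ord_recl big_ord0 /cofactor.
rewrite !(expand_det_row _ 0) !big_ord_recl !big_ord0 /cofactor !det_mx11 !mxE.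
(* The expansion produces several forms of the same index; naming entries by natural numbers lets
   [ring] identify them. *)
pose m i j := M (inord i) (inord j).
have Mm i j : M i j = m i j by rewrite /m !inord_val.
rewrite !Mm /=.

ring.
Qed.

Lemma dotE (R : realType) (a b : 'rV[R]_3) :
  dot a b = a 0 0 * b 0 0 + a 0 1 * b 0 1 + a 0 2 * b 0 2.
Proof.
rewrite /dot !big_ord_recl big_ord0 addr0 addrA; congr (_ * _ + _ * _ + _ * _).
all: by congr (_ _ _); apply: val_inj.
Qed.

Lemma det3E (R : realType) (a b c : 'rV[R]_3) :
  det3 a b c = a 0 0 * (b 0 1 * c 0 2 - b 0 2 * c 0 1)
             - a 0 1 * (b 0 0 * c 0 2 - b 0 2 * c 0 0)
             + a 0 2 * (b 0 0 * c 0 1 - b 0 1 * c 0 0).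
Proof.
rewrite /det3 det_mx3.
have E0 j : col_mx a (col_mx b c) 0 j = a 0 j.
  by rewrite -[RHS](col_mxEu a (col_mx b c)); congr (col_mx _ _ _ _); apply: val_inj.
have E1 j : col_mx a (col_mx b c) 1 j = b 0 j.
  rewrite -[RHS](col_mxEu b c) -[RHS](col_mxEd a); congr (col_mx _ _ _ _); exact: val_inj.
have E2 j : col_mx a (col_mx b c) 2 j = c 0 j.
  rewrite -[RHS](col_mxEd b c) -[RHS](col_mxEd a); congr (col_mx _ _ _ _); exact: val_inj.
by rewrite !E0 !E1 !E2.
Qed.

Lemma normsq_cross (R : realType) (a b : 'rV[R]_3) :
  normsq (cross a b) = normsq a * normsq b - dot a b ^+ 2.
Proof.
rewrite /normsq !dotE /cross !mxE !det3E !mxE /=.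
ring.
Qed.

(** Here a × b = det(a, b, n) n. The identity in the proof is Cramer's rule for the four vectors
    [a], [b], [w], [n], paired with [n]. *)
Lemma det3_normal (R : realType) (a b n w : 'rV[R]_3) :
  normsq n = 1 -> dot a n = 0 -> dot b n = 0 ->
  det3 a b w = det3 a b n * dot n w.
Proof.
move=> n1 an bn; rewrite -[LHS]mulr1 -n1.
transitivity (dot a n * det3 n b w + dot b n * det3 a n w + det3 a b n * dot n w).
  by rewrite /normsq !dotE !det3E; ring.
by rewrite an bn !mul0r !add0r.
Qed.

(** The Gram determinant of [a], [b], [n] is the square of their determinant; orthogonality to the
    unit vector [n] reduces it to a 2 by 2 one. *)
Lemma gram_normal (R : realType) (a b n : 'rV[R]_3) :
  normsq n = 1 -> dot a n = 0 -> dot b n = 0 ->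
  normsq a * normsq b - dot a b ^+ 2 = det3 a b n ^+ 2.
Proof.
move=> n1 an bn.
have -> : det3 a b n ^+ 2 = (normsq a * normsq b - dot a b ^+ 2) * normsq n
    + 2 * dot a b * dot a n * dot b n - normsq a * dot b n ^+ 2
    - normsq b * dot a n ^+ 2.
  by rewrite /normsq !dotE !det3E; ring.
by rewrite n1 an bn; ring.
Qed.

Lemma det3_neq0_normsq (R : realType) (a b n : 'rV[R]_3) :
  normsq n = 1 -> dot a n = 0 -> dot b n = 0 -> det3 a b n != 0 ->
  normsq a != 0.
Proof.
move=> n1 an bn; apply: contra_neq => a0; have := gram_normal n1 an bn.
rewrite a0; nra.
Qed.

Lemma dot_basis_eq0 (R : realType) (a b c w : 'rV[R]_3) :
  det3 a b c != 0 -> dot a w = 0 -> dot b w = 0 -> dot c w = 0 -> w = 0.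
Proof.
move=> d0 aw bw cw; apply/rowP => j; rewrite mxE.
(* Cramer's rule: the expansion of [w] in the basis dual to [a], [b], [c]. *)
have H k : det3 a b c * w 0 k = dot a w * det3 (delta_mx 0 k) b c
    + dot b w * det3 a (delta_mx 0 k) c + dot c w * det3 a b (delta_mx 0 k).
  rewrite !dotE !det3E.
  have [->|->|->] : [\/ k = 0, k = 1 | k = 2].
    by case: k => [[|[|[|]]]] // ?; [apply: Or31|apply: Or32|apply: Or33]; apply: val_inj.
  - by rewrite !mxE /=; ring.
  - by rewrite !mxE /=; ring.
  - by rewrite !mxE /=; ring.
have := H j; rewrite aw bw cw !mul0r !addr0 => /eqP.
by rewrite mulf_eq0 (negbTE d0) => /eqP.
Qed.

(** * Differentiation of dot and triple products *)

Lemma dot_differentiable (R : realType) (V : normedModType R)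
    (a b : V -> 'rV[R]_3) (x : V) :
  differentiable a x -> differentiable b x ->
  differentiable (fun y => dot (a y) (b y)) x.
Proof.
move=> da db; pose A i y := a y 0 i; pose B i y := b y 0 i.
have -> : (fun y => dot (a y) (b y)) = A 0 * B 0 + A 1 * B 1 + A 2 * B 2.
  by apply/funext => y; rewrite dotE.
have dA i : differentiable (A i) x by exact: coord_differentiable.
have dB i : differentiable (B i) x by exact: coord_differentiable.
by apply: differentiableD; [apply: differentiableD|]; apply: differentiableM.
Qed.

Lemma derive_dot (R : realType) (V : normedModType R)
    (a b : V -> 'rV[R]_3) (x v : V) :
  differentiable a x -> differentiable b x ->
  'D_v (fun y => dot (a y) (b y)) x = dot ('D_v a x) (b x) + dot (a x) ('D_v b x).
Proof.
move=> da db; pose A i y := a y 0 i; pose B i y := b y 0 i.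
have -> : (fun y => dot (a y) (b y)) = A 0 * B 0 + A 1 * B 1 + A 2 * B 2.
  by apply/funext => y; rewrite dotE.
have dA i : derivable (A i) x v by apply/diff_derivable/coord_differentiable.
have dB i : derivable (B i) x v by apply/diff_derivable/coord_differentiable.
have dAB i : derivable (A i * B i) x v by exact: derivableM.
rewrite (deriveD (derivableD (dAB 0) (dAB 1)) (dAB 2)) (deriveD (dAB 0) (dAB 1)).
rewrite !(deriveM (dA _) (dB _)) !(derive_coord v 0 _ da) !(derive_coord v 0 _ db) !dotE.
by rewrite /GRing.scale/= /A /B; ring.
Qed.

Lemma det3_differentiable (R : realType) (V : normedModType R)
    (a b c : V -> 'rV[R]_3) (x : V) :
  differentiable a x -> differentiable b x -> differentiable c x ->
  differentiable (fun y => det3 (a y) (b y) (c y)) x.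
Proof.
move=> da db dc.
have -> : (fun y => det3 (a y) (b y) (c y)) = fun y => dot (a y) (cross (b y) (c y)).
  by apply/funext => y; rewrite dotE det3E /cross !mxE !det3E !mxE /=; ring.
apply: dot_differentiable => //; apply: row_differentiable => j.
pose B i y := b y 0 i; pose C i y := c y 0 i.
pose e i := (delta_mx 0 j : 'rV[R]_3) 0 i.
have -> : (fun y => cross (b y) (c y) 0 j) =
    e 0 *: (B 1 * C 2 - B 2 * C 1) - e 1 *: (B 0 * C 2 - B 2 * C 0)
    + e 2 *: (B 0 * C 1 - B 1 * C 0).
  by apply/funext => y; rewrite /cross mxE det3E.
have dB i : differentiable (B i) x by exact: coord_differentiable.
have dC i : differentiable (C i) x by exact: coord_differentiable.
have dBC i k : differentiable (B i * C k) x by exact: differentiableM.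
by apply: differentiableD; [apply: differentiableB|];
   apply: differentiableZ; apply: differentiableB.
Qed.

(** The pointwise form in which smoothness mostly enters: it passes easily to [f \o Y]. The
    third-order derivative in the torsion is reached through [phi]. *)
Definition twice_differentiable (R : realType) (V W : normedModType R)
    (h : V -> W) (x : V) : Prop :=
  differentiable h x /\ forall w, differentiable ('D_w h) x.

Lemma smooth_on_twice (R : realType) (V W : normedModType R) (A : set V)
    (h : V -> W) (x : V) :
  smooth_on A h -> A x -> twice_differentiable h x.
Proof.
move=> sh Ax; have [hd hw] := sh 2%N; split; first exact: hd.
by move=> w; have [+ _] := hw w; exact.
Qed.

Lemma smooth_on_continuous (R : realType) (V W : normedModType R) (A : set V)
    (h : V -> W) (x : V) :
  smooth_on A h -> A x -> {for x, continuous h}.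
Proof. by move=> /(_ 0%N); exact. Qed.

Lemma derive_comp (R : realType) (U V W : normedModType R) (h : U -> V)
    (k : V -> W) (x w : U) :
  differentiable h x -> differentiable k (h x) ->
  'D_w (k \o h) x = 'd k (h x) ('D_w h x).
Proof.
move=> dh dk; rewrite deriveE; last exact: differentiable_comp.
by rewrite diff_comp //= deriveE.
Qed.

Lemma plane_vec2 (R : realType) (w : 'rV[R]_2) :
  w = w 0 0 *: vec2 1 0 + w 0 1 *: vec2 0 1.
Proof.
apply/rowP => j; rewrite !mxE.
have [->|->] : j = 0 \/ j = 1 by case: j => [[|[|]]] // ?; [left|right]; apply: val_inj.
- by rewrite /= mulr1 mulr0 addr0.
- by rewrite /= mulr1 mulr0 add0r.
Qed.

Lemma diff_plane (R : realType) (W : normedModType R) (h : 'rV[R]_2 -> W)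
    (y w : 'rV[R]_2) :
  differentiable h y -> 'd h y w = w 0 0 *: du h y + w 0 1 *: dv h y.
Proof. by move=> dh; rewrite {1}(plane_vec2 w) linearD !linearZ /du /dv !deriveE. Qed.

(** Near [x], the chain rule writes ['D_w (f \o Y)] as a combination of [du f \o Y] and [dv f \o Y]
    whose coefficients are the entries of ['D_w Y]; every factor is differentiable. *)
Lemma comp_twice_differentiable (R : realType) (Sigma V : set 'rV[R]_2) n
    (f : 'rV[R]_2 -> 'rV[R]_n) (Y : 'rV[R]_2 -> 'rV[R]_2) (x : 'rV[R]_2) :
  smooth_on Sigma f -> smooth_on V Y -> open V -> (forall y, V y -> Sigma (Y y)) ->
  V x -> twice_differentiable (f \o Y) x.
Proof.
move=> sf sY oV VS Vx; have [dY dY2] := smooth_on_twice sY Vx.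
have [df df2] := smooth_on_twice sf (VS _ Vx).
split=> [|w]; first exact: differentiable_comp.
pose k y := 'D_w Y y 0 0 *: (du f \o Y) y + 'D_w Y y 0 1 *: (dv f \o Y) y.
apply: (@near_eq_differentiable _ _ _ k).
  apply: filterS (open_nbhs_nbhs (conj oV Vx)) => y Vy; rewrite /k /=.
  have [dYy _] := smooth_on_twice sY Vy; have [dfy _] := smooth_on_twice sf (VS _ Vy).
  by rewrite (derive_comp w dYy dfy) diff_plane.
apply: differentiableD; apply: scale_differentiable.
- exact: coord_differentiable (dY2 w).
- exact: differentiable_comp dY (df2 _).
- exact: coord_differentiable (dY2 w).
- exact: differentiable_comp dY (df2 _).
Qed.

(** * Passing to the limit on the u-axis, and the quadratic equation of the principal curvatures *)

Lemma vcoord_differentiable (R : realType) (x : 'rV[R]_2) :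
  differentiable (@vcoord R) x.
Proof. exact: differentiable_coord. Qed.

Lemma derive_vcoord (R : realType) (x w : 'rV[R]_2) : 'D_w (@vcoord R) x = w 0 1.
Proof.
rewrite (@derive_coord _ _ _ _ id x w 0 1); last exact: ex_diff.
by rewrite derive_id.
Qed.

(** The complement of the u-axis is dense: if [P x] were non-zero, [vcoord] would vanish near [x],
    whereas its v-derivative is 1. This carries identities divided by [v] over to the axis. *)
Lemma axis_eq0 (R : realType) (P : 'rV[R]_2 -> R) (x : 'rV[R]_2) :
  {for x, continuous P} -> (\forall y \near x, vcoord y != 0 -> P y = 0) ->
  P x = 0.
Proof.
move=> cP Pv; apply/eqP/negPn/negP => Px.
have Pn : \forall y \near x, P y != 0.
  exact: cvgr_neq0 cP Px.
have v0 : \forall y \near x, vcoord y = cst 0 y.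
  by apply: filterS2 Pv Pn => y yv Py; apply/eqP/negPn/negP => /yv /eqP; rewrite (negbTE Py).
have := near_eq_derive (vec2 0 1) v0.
by rewrite derive_vcoord derive_cst mxE /= => /eqP; rewrite oner_eq0.
Qed.

Lemma derive_dot_cst (R : realType) (V : normedModType R)
    (a b : V -> 'rV[R]_3) (x v : V) (c : R) :
  differentiable a x -> differentiable b x ->
  (\forall y \near x, dot (a y) (b y) = c) ->
  dot ('D_v a x) (b x) = - dot (a x) ('D_v b x).
Proof.
move=> da db ab; apply/eqP; rewrite -subr_eq0 opprK -derive_dot//.
have ab' : \forall y \near x, dot (a y) (b y) = cst c y by [].
by rewrite (near_eq_derive v ab') derive_cst.
Qed.

(** Multiplying by [4 * v * D] completes the square, which treats both signs of the root alike. The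
    sign condition on the discriminant matters because [Num.sqrt] is 0 on negative numbers. *)
Lemma quadratic_root (R : realType) (v D A Q k : R) :
  v != 0 -> D != 0 -> 0 <= A ^+ 2 - 4 * v * D * Q ->
  let B := Num.sqrt (A ^+ 2 - 4 * v * D * Q) in
  k = (A - B) / (2 * v * D) \/ k = (A + B) / (2 * v * D) ->
  v * D * k ^+ 2 - A * k + Q = 0.
Proof.
move=> v0 D0 disc B kE; have B2 : B ^+ 2 = A ^+ 2 - 4 * v * D * Q by rewrite sqr_sqrtr.
have vD : 4 * v * D != 0 by rewrite !mulf_neq0// pnatr_eq0.
apply: (mulfI vD); rewrite mulr0.
transitivity ((2 * v * D * k - A) ^+ 2 - (A ^+ 2 - 4 * v * D * Q)); first by ring.
rewrite -B2.
have vD2 : 2 * v * D != 0 by rewrite !mulf_neq0// pnatr_eq0.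
by case: kE => ->; rewrite mulrC divfK//; ring.
Qed.

(** * Fronts in adapted coordinates *)

(** The frontal conditions read in coordinates. Immersivity of the pair is kept apart; it enters as
    the non-vanishing of the derivative of [n] in a null direction. *)
Definition frontal_on (R : realType) (V : set 'rV[R]_2)
    (g n : 'rV[R]_2 -> 'rV[R]_3) : Prop :=
  forall x, V x ->
    [/\ twice_differentiable g x, twice_differentiable n x, normsq (n x) = 1,
        dot (du g x) (n x) = 0 & dot (dv g x) (n x) = 0].

Lemma dotC (R : realType) (a b : 'rV[R]_3) : dot a b = dot b a.
Proof. by rewrite !dotE; ring. Qed.

Lemma dotZl (R : realType) (k : R) (a b : 'rV[R]_3) :
  dot (k *: a) b = k * dot a b.
Proof. by rewrite !dotE !mxE; ring. Qed.

Lemma dot0l (R : realType) (a : 'rV[R]_3) : dot 0 a = 0.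
Proof. by rewrite !dotE !mxE; ring. Qed.

Lemma dot_vcoord_eq0 (R : realType) (V : set 'rV[R]_2)
    (phi n : 'rV[R]_2 -> 'rV[R]_3) (x : 'rV[R]_2) :
  open V -> V x -> differentiable phi x -> differentiable n x ->
  (forall y, V y -> dot (vcoord y *: phi y) (n y) = 0) ->
  dot (phi x) (n x) = 0.
Proof.
move=> oV Vx dphi dn vphin; apply: (@axis_eq0 _ (fun y => dot (phi y) (n y))).
  exact/differentiable_continuous/dot_differentiable.
apply: filterS (open_nbhs_nbhs (conj oV Vx)) => y Vy v0.
by have /eqP := vphin y Vy; rewrite dotZl mulf_eq0 (negbTE v0) => /eqP.
Qed.

(** * Calculus of the coordinate derivatives [du] and [dv] *)

Lemma near_eq_du (R : realType) (W : normedModType R) (h k : 'rV[R]_2 -> W) x :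
  (\forall y \near x, h y = k y) -> du h x = du k x.
Proof. exact: near_eq_derive. Qed.

Lemma near_eq_dv (R : realType) (W : normedModType R) (h k : 'rV[R]_2 -> W) x :
  (\forall y \near x, h y = k y) -> dv h x = dv k x.
Proof. exact: near_eq_derive. Qed.

Lemma du_dot_cst (R : realType) (a b : 'rV[R]_2 -> 'rV[R]_3) x (c : R) :
  differentiable a x -> differentiable b x ->
  (\forall y \near x, dot (a y) (b y) = c) ->
  dot (a x) (du b x) = - dot (du a x) (b x).
Proof. by move=> da db ab; rewrite (derive_dot_cst _ da db ab) opprK. Qed.

Lemma dv_dot_cst (R : realType) (a b : 'rV[R]_2 -> 'rV[R]_3) x (c : R) :
  differentiable a x -> differentiable b x ->
  (\forall y \near x, dot (a y) (b y) = c) ->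
  dot (a x) (dv b x) = - dot (dv a x) (b x).
Proof. by move=> da db ab; rewrite (derive_dot_cst _ da db ab) opprK. Qed.

Lemma du_vcoord_scale (R : realType) n (h : 'rV[R]_2 -> 'rV[R]_n) x :
  differentiable h x -> du (fun y => vcoord y *: h y) x = vcoord x *: du h x.
Proof.
move=> dh; rewrite [LHS]derive_scale//; last exact: vcoord_differentiable.
by rewrite derive_vcoord mxE /= scale0r add0r.
Qed.

Lemma dv_vcoord_scale (R : realType) n (h : 'rV[R]_2 -> 'rV[R]_n) x :
  differentiable h x ->
  dv (fun y => vcoord y *: h y) x = h x + vcoord x *: dv h x.
Proof.
move=> dh; rewrite [LHS]derive_scale//; last exact: vcoord_differentiable.
by rewrite derive_vcoord mxE /= scale1r.
Qed.

Lemma du_differentiable (R : realType) (W : normedModType R) (h : 'rV[R]_2 -> W) x :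
  twice_differentiable h x -> differentiable (du h) x.
Proof. by case=> _; exact. Qed.

Lemma dv_differentiable (R : realType) (W : normedModType R) (h : 'rV[R]_2 -> W) x :
  twice_differentiable h x -> differentiable (dv h) x.
Proof. by case=> _; exact. Qed.

Lemma dv_du_comm (R : realType) n (h : 'rV[R]_2 -> 'rV[R]_n) x :
  (\forall y \near x, twice_differentiable h y) -> dv (du h) x = du (dv h) x.
Proof.
move=> dh; have [_ dx] := nbhs_singleton dh.
by apply: derive_derive_comm_row => //; apply: filterS dh => y [].
Qed.

(** * The second fundamental form of a frontal in coordinates *)

Section Frontal.
Variables (R : realType) (V : set 'rV[R]_2) (g n : 'rV[R]_2 -> 'rV[R]_3).
Hypotheses (oV : open V) (gn : frontal_on V g n).

Lemma near_domain x : V x -> \forall y \near x, V y.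
Proof. by move=> Vx; exact: open_nbhs_nbhs. Qed.

Lemma dot_n_du_n x : V x -> dot (n x) (du n x) = 0.
Proof.
move=> Vx; have [_ [dn _] _ _ _] := gn Vx.
have : dot (n x) (du n x) = - dot (du n x) (n x).
  apply: du_dot_cst (1 : R) _ _ _ => //.
  by apply: filterS (near_domain Vx) => y Vy; have [_ _] := gn Vy.
rewrite [X in - X]dotC; lra.
Qed.

Lemma dot_n_dv_n x : V x -> dot (n x) (dv n x) = 0.
Proof.
move=> Vx; have [_ [dn _] _ _ _] := gn Vx.
have : dot (n x) (dv n x) = - dot (dv n x) (n x).
  apply: dv_dot_cst (1 : R) _ _ _ => //.
  by apply: filterS (near_domain Vx) => y Vy; have [_ _] := gn Vy.
rewrite [X in - X]dotC; lra.
Qed.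

Lemma dot_du_du x : V x -> dot (du g x) (du n x) = - dot (du (du g) x) (n x).
Proof.
move=> Vx; have [dg [dn _] _ _ _] := gn Vx.
apply: du_dot_cst (0 : R) (du_differentiable dg) dn _.
by apply: filterS (near_domain Vx) => y Vy; have [] := gn Vy.
Qed.

(* Symmetry of the second fundamental form. *)
Lemma dot_du_dv x : V x -> dot (du g x) (dv n x) = dot (dv g x) (du n x).
Proof.
move=> Vx; have [dg [dn _] _ _ _] := gn Vx.
have A : dot (du g x) (dv n x) = - dot (dv (du g) x) (n x).
  apply: dv_dot_cst (0 : R) (du_differentiable dg) dn _.
  by apply: filterS (near_domain Vx) => y Vy; have [] := gn Vy.
have B : dot (dv g x) (du n x) = - dot (du (dv g) x) (n x).
  apply: du_dot_cst (0 : R) (dv_differentiable dg) dn _.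
  by apply: filterS (near_domain Vx) => y Vy; have [] := gn Vy.
have C : dv (du g) x = du (dv g) x.
  by apply: dv_du_comm; apply: filterS (near_domain Vx) => y Vy; have [] := gn Vy.
by rewrite C in A; exact: etrans A (esym B).
Qed.

(** * Points of the first kind: curvature, principal vector and torsion on the axis *)

Section First.
Variable phi : 'rV[R]_2 -> 'rV[R]_3.
Hypothesis dphi : forall x, V x -> twice_differentiable phi x.
Hypothesis gphi : forall x, V x -> dv g x = vcoord x *: phi x.

Lemma first_phi_normal x : V x -> dot (phi x) (n x) = 0.
Proof.
move=> Vx; have [_ [dn _] _ _ _] := gn Vx; have [dph _] := dphi Vx.
apply: (dot_vcoord_eq0 oV) => // y Vy; rewrite -gphi//.
by have [] := gn Vy.
Qed.

Lemma dvvu_first x : V x -> vcoord x = 0 -> dv (dv (du g)) x = du phi x.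
Proof.
move=> Vx v0; have dph := du_differentiable (dphi Vx).
transitivity (dv (fun y => vcoord y *: du phi y) x); last first.
  by rewrite dv_vcoord_scale// v0 scale0r addr0.
apply: near_eq_dv; apply: filterS (near_domain Vx) => y Vy.
(* Off the axis too, [g_uv] is the u-derivative of [v phi], hence [v phi_u], as [v] is constant in
   the direction u. *)
rewrite dv_du_comm; last first.
  by apply: filterS (near_domain Vy) => z Vz; have [] := gn Vz.
have [dphy _] := dphi Vy; rewrite -du_vcoord_scale//; apply: near_eq_du.
by apply: filterS (near_domain Vy) => z; exact: gphi.
Qed.

Lemma torsion_first x : V x -> vcoord x = 0 -> det3 (du g x) (phi x) (n x) != 0 ->
  FirstKind.cusp_directional_torsion g phi x = 0 <->
  FirstKind.E g x * FirstKind.M n phi x - FirstKind.L g n x * FirstKind.F g phi x = 0.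
Proof.
move=> Vx v0 c0; have [_ [dn _] n1 un _] := gn Vx; have [dph _] := dphi Vx.
have pn := first_phi_normal Vx.
have ME : dot (n x) (du phi x) = FirstKind.M n phi x.
  rewrite /FirstKind.M dotC (du_dot_cst (c := 0) dph dn) ?opprK//.
  by apply: filterS (near_domain Vx) => y Vy; exact: first_phi_normal.
have LE : dot (n x) (du (du g) x) = FirstKind.L g n x.
  by rewrite /FirstKind.L dotC dot_du_du// opprK.
have E0 := det3_neq0_normsq n1 un pn c0.
have SE : normsq (cross (du g x) (phi x)) = det3 (du g x) (phi x) (n x) ^+ 2.
  exact: etrans (normsq_cross _ _) (gram_normal n1 un pn).
rewrite /FirstKind.cusp_directional_torsion dvvu_first// SE.
rewrite (det3_normal (du phi x) n1 un pn) (det3_normal (du (du g) x) n1 un pn).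
rewrite ME LE /FirstKind.E /FirstKind.F.
move: E0 c0; set c := det3 _ _ _; set e := normsq _; set F := dot _ _ => e0 c0.
set M := FirstKind.M _ _ _; set L := FirstKind.L _ _ _.
(* The torsion is (EM - LF) / (cE), so it vanishes exactly with its numerator. *)
have -> : c * M / c ^+ 2 - c * L * F / (e * c ^+ 2) = (e * M - L * F) / (c * e).
  by field; rewrite e0 c0.
split=> [/eqP|->]; last by rewrite mul0r.
by rewrite mulf_eq0 invr_eq0 mulf_eq0 (negbTE c0) (negbTE e0) /= orbF => /eqP.
Qed.

(** On the axis [g_v = 0], so symmetry of the second fundamental form makes [n_v] orthogonal to
    [g_u]; it is also orthogonal to [n]. With [N = 0] it would be orthogonal to a whole basis. *)
Lemma first_N_neq0 x : V x -> vcoord x = 0 -> dv n x != 0 ->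
  det3 (du g x) (phi x) (n x) != 0 -> FirstKind.N n phi x != 0.
Proof.
move=> Vx v0 + c0; apply: contra_neq => /eqP; rewrite oppr_eq0 => /eqP N0.
apply: (dot_basis_eq0 c0) => //; last exact: dot_n_dv_n.
have E := dot_du_dv Vx; by rewrite (gphi Vx) v0 scale0r dot0l in E.
Qed.

(** The signed area density in the chart is [v c]; thus [c 0 != 0] expresses non-degeneracy. *)
Let c x := det3 (du g x) (phi x) (n x).
Let Q x := FirstKind.L g n x * FirstKind.N n phi x - vcoord x * FirstKind.M n phi x ^+ 2.

Lemma first_coeffs_differentiable x : V x ->
  [/\ differentiable c x, differentiable (FirstKind.D g phi) x,
      differentiable (FirstKind.A g n phi) x & differentiable Q x].
Proof.
move=> Vx; have [dg dn _ _ _] := gn Vx; have [dph _] := dphi Vx.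
have dug := du_differentiable dg.
have dun := du_differentiable dn; have dvn := dv_differentiable dn.
have dv0 := vcoord_differentiable x.
have dE : differentiable (FirstKind.E g) x := dot_differentiable dug dug.
have dF : differentiable (FirstKind.F g phi) x := dot_differentiable dug dph.
have dG : differentiable (FirstKind.G phi) x := dot_differentiable dph dph.
have dL : differentiable (FirstKind.L g n) x.
  exact: differentiableN (dot_differentiable dug dun).
have dM : differentiable (FirstKind.M n phi) x.
  exact: differentiableN (dot_differentiable dph dun).
have dN : differentiable (FirstKind.N n phi) x.
  exact: differentiableN (dot_differentiable dph dvn).
split.
- exact: det3_differentiable dug dph dn.1.
- exact: differentiableB (differentiableM dE dG) (differentiableM dF dF).
- have -> : FirstKind.A g n phi = FirstKind.E g * FirstKind.N n phi
      - 2 *: (@vcoord R * (FirstKind.F g phi * FirstKind.M n phi))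
      + @vcoord R * (FirstKind.G phi * FirstKind.L g n).
    apply/funext => y; rewrite /FirstKind.A !fctE /GRing.scale /=.
    by congr (_ - _ + _); rewrite !mulrA.
  apply: differentiableD (differentiableM dv0 (differentiableM dG dL)).
  exact: differentiableB (differentiableM dE dN)
    (differentiableZ _ (differentiableM dv0 (differentiableM dF dM))).
- exact: differentiableB (differentiableM dL dN)
    (differentiableM dv0 (differentiableM dM dM)).
Qed.

(** Off the axis [kappa] is a root of v D k^2 - A k + Q. By continuity this persists on the axis,
    where it reads E N k = L N, and [N] cancels. *)
Lemma first_curvature_axis kappa : V 0 ->
  (forall x, V x -> vcoord x = 0 -> dv n x != 0) -> c 0 != 0 ->
  bounded_principal_curvature (FirstKind.kappa_plus g n phi)
    (FirstKind.kappa_minus g n phi) kappa ->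
  \forall x \near (0 : 'rV[R]_2), vcoord x = 0 ->
    FirstKind.E g x * kappa x = FirstKind.L g n x.
Proof.
move=> V0 vn0 c0 [[K oK sK] kappaE].
have v0 : vcoord (0 : 'rV[R]_2) = 0 by rewrite /vcoord mxE.
have [dc0 dD0 dA0 dQ0] := first_coeffs_differentiable V0.
have cn : \forall x \near (0 : 'rV[R]_2), c x != 0 by exact: cvgr_neq0 (differentiable_continuous dc0) c0.
have D2 x : V x -> FirstKind.D g phi x = c x ^+ 2.
  by move=> Vx; have [_ _ n1 un _] := gn Vx; apply: gram_normal (first_phi_normal Vx).
pose disc := FirstKind.A g n phi * FirstKind.A g n phi
  - 4 *: (@vcoord R * FirstKind.D g phi * Q).
have discE x : disc x = FirstKind.A g n phi x ^+ 2
    - 4 * vcoord x * FirstKind.D g phi x * Q x.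
  by rewrite /disc !fctE /GRing.scale /= !mulrA.
(* At [v = 0] the discriminant is the square of E N, which is non-zero; so it stays positive near
   the origin and the square root there is genuine. *)
have disc0 : 0 < disc 0.
  rewrite discE v0 mulr0 !mul0r subr0 exprn_even_gt0//=.
  rewrite /FirstKind.A v0 mulr0 !mul0r subr0 addr0 mulf_neq0//.
    have [_ _ n1 un _] := gn V0.
    exact: det3_neq0_normsq n1 un (first_phi_normal V0) c0.
  exact: first_N_neq0 (vn0 _ V0 v0) c0.
have dn : \forall x \near (0 : 'rV[R]_2), 0 < disc x.
  suff cd : {for 0, continuous disc} by exact: cvgr_gt cd _ disc0.
  apply: differentiable_continuous.
  apply: differentiableB (differentiableM dA0 dA0) _.
  apply: differentiableZ (differentiableM (differentiableM _ dD0) dQ0).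
  exact: vcoord_differentiable.
pose P x := vcoord x * FirstKind.D g phi x * kappa x ^+ 2
  - FirstKind.A g n phi x * kappa x + Q x.
have Pn : \forall x \near (0 : 'rV[R]_2), vcoord x != 0 -> P x = 0.
  have kn : \forall x \near (0 : 'rV[R]_2), vcoord x != 0 ->
      kappa x = FirstKind.kappa_plus g n phi x \/
      kappa x = FirstKind.kappa_minus g n phi x.
    by case: kappaE; apply: filterS => x kx vx; [left|right]; exact: kx.
  near=> x => vx.
  have Vx : V x by near: x; exact: near_domain.
  have kx : kappa x = FirstKind.kappa_plus g n phi x \/
      kappa x = FirstKind.kappa_minus g n phi x by move: vx; near: x.
  have cx : c x != 0 by near: x.
  have dx : 0 < disc x by near: x.
  apply: (quadratic_root vx _ _ kx).
  - by rewrite (D2 _ Vx) expf_neq0.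
  - by rewrite -discE; exact: ltW.
near=> x => vx.
have Vx : V x by near: x; exact: near_domain.
have Kx : K x by near: x; exact: open_nbhs_nbhs.
have cx : c x != 0 by near: x.
have [dk _] := smooth_on_twice sK Kx.
have [dc dD dA dQ] := first_coeffs_differentiable Vx.
have Px : P x = 0.
  (* [axis_eq0] needs the relation in a neighbourhood of the axis point [x] itself, which
     [near_join] extracts from its validity near the origin. *)
  apply: axis_eq0; last by near: x; exact: (near_join Pn).
  apply: differentiable_continuous.
  have -> : P = @vcoord R * FirstKind.D g phi * (kappa * kappa)
      - FirstKind.A g n phi * kappa + Q by [].
  apply: differentiableD dQ.
  apply: differentiableB (differentiableM dA dk).
  apply: differentiableM (differentiableM dk dk).
  exact: differentiableM (vcoord_differentiable x) dD.
have N0 := first_N_neq0 Vx vx (vn0 _ Vx vx) cx.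
apply: (mulfI N0); move: Px.
rewrite /P /Q /FirstKind.A vx mulr0 !mul0r subr0 addr0 subr0.
move: (FirstKind.E g x) (FirstKind.N n phi x) (FirstKind.L g n x) (kappa x).
move=> e N L k Pe; apply/eqP; rewrite -subr_eq0; apply/eqP.
by rewrite -[RHS]oppr0 -Pe; ring.
Unshelve. all: by end_near. Qed.

(** With [kappa] equal to L/E on the axis, the second component -M + kappa F, multiplied by -E, is
    the numerator EM - LF of the torsion. *)
Lemma first_principal_torsion kappa : V 0 ->
  (forall x, V x -> vcoord x = 0 -> dv n x != 0) -> c 0 != 0 ->
  bounded_principal_curvature (FirstKind.kappa_plus g n phi)
    (FirstKind.kappa_minus g n phi) kappa ->
  \forall x \near (0 : 'rV[R]_2), vcoord x = 0 ->
    (FirstKind.principal_vector g n phi kappa x 0 1 = 0 <->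
     FirstKind.cusp_directional_torsion g phi x = 0).
Proof.
move=> V0 vn0 c0 bk; have kn := first_curvature_axis V0 vn0 c0 bk.
have [dc0 _ _ _] := first_coeffs_differentiable V0.
have cn : \forall x \near (0 : 'rV[R]_2), c x != 0 by exact: cvgr_neq0 (differentiable_continuous dc0) c0.
near=> x => vx.
have Vx : V x by near: x; exact: near_domain.
have cx : c x != 0 by near: x.
have kx : FirstKind.E g x * kappa x = FirstKind.L g n x by move: vx; near: x.
have [_ _ n1 un _] := gn Vx.
have e0 : FirstKind.E g x != 0 := det3_neq0_normsq n1 un (first_phi_normal Vx) cx.
apply: iff_trans (iff_sym (torsion_first Vx vx cx)).
rewrite -kx /FirstKind.principal_vector mxE /=.
set e := FirstKind.E g x in e0 *; set M := FirstKind.M _ _ _; set F := FirstKind.F _ _ _.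
have -> : e * M - e * kappa x * F = - e * (- M + kappa x * F) by ring.
split=> [->|/eqP]; first by rewrite mulr0.
by rewrite mulf_eq0 oppr_eq0 (negbTE e0) => /eqP.
Unshelve. all: by end_near. Qed.

End First.

(** * Points of the second kind: the principal vector at the origin *)

Section Second.
Variables (eps : R -> R) (phi : 'rV[R]_2 -> 'rV[R]_3).
Hypothesis eps0 : eps 0 = 0.
Hypothesis gphi : forall x, V x ->
  du g x + eps (ucoord x) *: dv g x = vcoord x *: phi x.

Lemma second_principal_vector0 kappa : V 0 -> du n 0 != 0 ->
  det3 (phi 0) (dv g 0) (n 0) != 0 ->
  SecondKind.principal_vector eps g n phi kappa 0 0 1 != 0.
Proof.
move=> V0 + c0.
have u0 : ucoord (0 : 'rV[R]_2) = 0 by rewrite /ucoord mxE.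
have v0 : vcoord (0 : 'rV[R]_2) = 0 by rewrite /vcoord mxE.
have du0 : du g 0 = 0.
  by have := gphi V0; rewrite u0 eps0 v0 !scale0r addr0.
(* At the origin the coefficient of [kappa] is zero, since [v] and [eps] both vanish there; what
   remains is [L]. *)
rewrite /SecondKind.principal_vector mxE /= u0 eps0 v0 !mul0r subr0 mulr0 subr0.
apply: contra_neq => /eqP; rewrite oppr_eq0 => /eqP L0.
apply: (dot_basis_eq0 c0 L0); last exact: dot_n_du_n.
by have E := dot_du_dv V0; rewrite du0 dot0l in E; exact: esym E.
Qed.

End Second.
End Frontal.

(** * Transport through the chart *)

Lemma det3_plane (R : realType) (a b n : 'rV[R]_3) (s t u v : R) :
  det3 (s *: a + t *: b) (u *: a + v *: b) n = (s * v - t * u) * det3 a b n.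
Proof. by rewrite !det3E !mxE; ring. Qed.

Section Chart.
Variables (R : realType) (Sigma : set 'rV[R]_2) (f nu : 'rV[R]_2 -> 'rV[R]_3).
Variables (p : 'rV[R]_2) (U V : set 'rV[R]_2) (X Y : 'rV[R]_2 -> 'rV[R]_2).
Hypotheses (fnu : front Sigma f nu) (XY : oriented_chart Sigma p U V X Y).

Lemma chart_V0 : V 0.
Proof.
have [[[_ Up] _ _ Xp] _ UV _ _] := XY; rewrite -Xp.
by have [] := UV _ Up.
Qed.

Lemma chart_open : open V. Proof. by have [[]] := XY. Qed.

Lemma chart_sub x : V x -> Sigma (Y x).
Proof.
by have [[_ US _ _] _ _ VU _] := XY => /VU [Ux _]; exact: US.
Qed.

Lemma chart_derive_inj x w : V x -> 'D_w Y x = 0 -> w = 0.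
Proof.
have [_ [sX sY] _ VU _] := XY => Vx Yw.
have [dY _] := smooth_on_twice sY Vx; have [dX _] := smooth_on_twice sX (VU _ Vx).1.
have E : \forall y \near x, (X \o Y) y = id y.
  by apply: filterS (open_nbhs_nbhs (conj chart_open Vx)) => y /VU [].
have := near_eq_derive w E; rewrite (derive_comp w dY dX) Yw linear0.
by rewrite derive_id.
Qed.

Lemma front_frontal_on : frontal_on V (f \o Y) (nu \o Y).
Proof.
have [sf [snu nu1 fn] _] := fnu; have [_ [_ sY] _ _ _] := XY.
move=> x Vx; have [dY _] := smooth_on_twice sY Vx.
have [df _] := smooth_on_twice sf (chart_sub Vx).
split.
- exact: (comp_twice_differentiable sf sY chart_open chart_sub).
- exact: (comp_twice_differentiable snu sY chart_open chart_sub).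
- exact/nu1/chart_sub.
- by rewrite /du (derive_comp _ dY df); exact/fn/chart_sub.
- by rewrite /dv (derive_comp _ dY df); exact/fn/chart_sub.
Qed.

(** If both derivatives vanished, the differential of the immersion [(f, nu)] would kill ['D_w Y x];
    then ['D_w Y x = 0], and [w = 0] because [Y] is a chart. *)
Lemma front_derive_normal_neq0 x w : V x -> w != 0 ->
  'D_w (f \o Y) x = 0 -> 'D_w (nu \o Y) x != 0.
Proof.
have [sf [snu _ _] imm] := fnu; have [_ [_ sY] _ _ _] := XY.
move=> Vx + fw; apply: contra_neq => nw; apply: (chart_derive_inj Vx).
have SY := chart_sub Vx; have [dY _] := smooth_on_twice sY Vx.
have [df _] := smooth_on_twice sf SY; have [dnu _] := smooth_on_twice snu SY.
apply: (imm _ SY); rewrite linear0 diff_pair//.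
congr pair; first exact: etrans (esym (derive_comp w dY df)) fw.
exact: etrans (esym (derive_comp w dY dnu)) nw.
Qed.

(** On the original domain the density is the Jacobian of [X] times the pullback of [v h]. As [v]
    vanishes at the origin, [h 0 = 0] would annihilate its differential at [p], against
    non-degeneracy. *)
Lemma front_density_factor_neq0 (h : 'rV[R]_2 -> R) :
  nondegenerate_singular Sigma f nu p -> differentiable h 0 ->
  (forall x, V x -> det3 (du (f \o Y) x) (dv (f \o Y) x) ((nu \o Y) x)
                    = vcoord x * h x) ->
  h 0 != 0.
Proof.
move=> [_ [w lw]] dh gh; apply: contraNneq lw => h0.
have [sf [snu _ _] _] := fnu.
have [[oU US _ Xp] [sX sY] UV _ _] := XY.
have [_ Up] := oU.
have nU : \forall q \near p, U q := open_nbhs_nbhs oU.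
have dl : differentiable (signed_area_density f nu) p.
  have [_ df] := smooth_on_twice sf (US _ Up).
  exact: det3_differentiable (df _) (df _) (smooth_on_twice snu (US _ Up)).1.
have [dX dX2] := smooth_on_twice sX Up.
have XpE : X p = 0 := Xp.
pose J := (fun q => du X q 0 0) * (fun q => dv X q 0 1)
  - (fun q => du X q 0 1) * (fun q => dv X q 0 0).
pose H := (@vcoord R \o X) * (h \o X).
have E : \forall q \near p, signed_area_density f nu q = (J * H) q.
  apply: filterS nU => q Uq; have [VX YX] := UV _ Uq.
  have [[dg _] _ _ _ _] := front_frontal_on VX.
  have [dXq _] := smooth_on_twice sX Uq.
  (* Chain rule for [f], written near [q] as [(f \o Y) \o X]. *)
  have fE v : 'D_v f q = 'd (f \o Y) (X q) ('D_v X q).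
    rewrite -(derive_comp _ dXq dg); apply: near_eq_derive.
    apply: filterS (open_nbhs_nbhs (conj oU.1 Uq)) => z Uz.
    by rewrite /= (UV _ Uz).2.
  have -> : signed_area_density f nu q
      = det3 ('d (f \o Y) (X q) (du X q)) ('d (f \o Y) (X q) (dv X q)) (nu q).
    by rewrite /signed_area_density /du /dv -!fE.
  rewrite (diff_plane (du X q) dg) (diff_plane (dv X q) dg).
  have -> : nu q = (nu \o Y) (X q) by rewrite /= YX.
  by rewrite det3_plane (gh _ VX).
have dJ : differentiable J p.
  by apply: differentiableB; apply: differentiableM; apply: coord_differentiable; exact: (dX2 _).
have dv' : differentiable (@vcoord R \o X) p.
  exact: differentiable_comp dX (vcoord_differentiable _).
have dh' : differentiable (h \o X) p by apply: differentiable_comp => //; rewrite XpE.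
have dH : differentiable H p by exact: differentiableM.
(* By Leibniz, each term of the derivative retains a factor [v] or [h] evaluated at the origin. *)
rewrite -deriveE// (near_eq_derive _ E) (deriveM (diff_derivable dJ) (diff_derivable dH)).
rewrite (deriveM (diff_derivable dv') (diff_derivable dh')) /H !fctE /= XpE h0.
by rewrite [vcoord 0]mxE /GRing.scale /= !(mul0r, addr0, mulr0).
Qed.

(** In the chart the singular curve runs along the u-axis with non-zero velocity, so tangency to it
    is the vanishing of the second component. *)
Lemma singular_curve_chart gam :
  singular_curve Sigma f p gam -> singular_on_u_axis Sigma f V Y ->
  (X \o gam) @ (0 : R) --> (0 : 'rV[R]_2) /\
  \forall t \near (0 : R),
    [/\ V (X (gam t)), vcoord (X (gam t)) = 0 &
        forall w, tangent_to ('d Y (X (gam t)) w) (derive1 gam t) <-> w 0 1 = 0].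
Proof.
move=> [gam0 [e e0 [sgam gam'0 [W oW SW]]]] ax.
have [[oU US _ Xp] [sX sY] UV _ _] := XY; have [_ Up] := oU.
have cgam (t : R) : `|t| < e -> {for t, continuous gam}.
  by move=> te; exact: (smooth_on_continuous sgam).
have nT (t : R) : `|t| < e -> U (gam t) -> \forall s \near t, `|s| < e /\ U (gam s).
  move=> te Ut; apply: filterI.
    have ct : {for t, continuous (fun s : R => `|s|)} by exact: norm_continuous.
    exact: cvgr_lt ct _ te.
  by apply: (cgam _ te); apply: open_nbhs_nbhs; split=> //; exact: oU.1.
have z0 : `|0 : R| < e by rewrite normr0.
have U0 : U (gam 0) by rewrite gam0.
have Xv t : `|t| < e -> U (gam t) -> V (X (gam t)) /\ vcoord (X (gam t)) = 0.
  (* The chart identifies axis points with singular points, and [gam t] is singular because [SW]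
     describes the singular set near [p] as the image of [gam]. *)
  move=> te Ut; have [VX YX] := UV _ Ut; split=> //; apply/(ax _ VX); rewrite YX.
  suff [] : (singular_set Sigma f `&` W) (gam t) by [].
  by rewrite SW; exists t.
split.
  rewrite -[X in _ --> X]Xp -gam0; apply: continuous_comp; first exact: cgam.
  exact: smooth_on_continuous sX U0.
apply: filterS (nT 0 z0 U0) => t [te Ut]; have [VX vX] := Xv t te Ut.
split=> // w; have [_ YX] := UV _ Ut.
have [dgam _] := smooth_on_twice sgam te.
have [dX _] := smooth_on_twice sX Ut; have [dY _] := smooth_on_twice sY VX.
have dXg : differentiable (X \o gam : R^o -> _) t by exact: differentiable_comp.
(* [b] is the velocity in the chart: its second component vanishes because the curve stays on the
   axis, and its first does not because ['d Y] sends [b] to the non-zero velocity of [gam]. *)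
set b := 'D_(1 : R^o) (X \o gam : R^o -> _) t.
have b1 : b 0 1 = 0.
  rewrite -(derive_coord _ _ _ dXg).
  have E : \forall s \near (t : R^o), (X \o gam) s 0 1 = cst 0 s.
    by apply: filterS (nT t te Ut) => s [se Us]; have [] := Xv s se Us.
  by rewrite (near_eq_derive _ E) derive_cst.
have gb : derive1 gam t = 'd Y (X (gam t)) b.
  rewrite derive1E -(derive_comp (k := Y) _ dXg)//; apply: near_eq_derive.
  by apply: filterS (nT t te Ut) => s [_ Us] /=; rewrite (UV _ Us).2.
have b0 : b 0 0 != 0.
  have := gam'0 t te; rewrite gb; apply: contra_neq => b0.
  by rewrite (plane_vec2 b) b0 b1 !scale0r addr0 linear0.
split.
  move=> [c]; rewrite gb -linearZ => /eqP; rewrite -subr_eq0 -linearB => /eqP.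
  rewrite -deriveE// => /(chart_derive_inj VX)/eqP; rewrite subr_eq0 => /eqP ->.
  by rewrite mxE b1 mulr0.
move=> w1; exists (w 0 0 / b 0 0); rewrite gb -linearZ; congr ('d Y _ _).
have bE : b = b 0 0 *: vec2 1 0 by rewrite {1}(plane_vec2 b) b1 scale0r addr0.
by rewrite {2}bE scalerA divfK// {1}(plane_vec2 w) w1 scale0r addr0.
Qed.

End Chart.

(** * The two cases, carried from the chart back to the singular curve *)

Theorem proposition3p3 :
  forall (R : realType) (Sigma : set 'rV[R]_2) (f nu : 'rV[R]_2 -> 'rV[R]_3)
    (p : 'rV[R]_2) (gam : R -> 'rV[R]_2),
  planar_domain Sigma -> front Sigma f nu -> nondegenerate_singular Sigma f nu p ->
  singular_curve Sigma f p gam ->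
  (cuspidal_edge f p ->
   forall (U V : set 'rV[R]_2) (X Y : 'rV[R]_2 -> 'rV[R]_2)
     (phi : 'rV[R]_2 -> 'rV[R]_3) (kappa : 'rV[R]_2 -> R),
   adapted_first Sigma f p U V X Y ->
   phi_first V (f \o Y) phi ->
   bounded_principal_curvature
     (FirstKind.kappa_plus (f \o Y) (nu \o Y) phi)
     (FirstKind.kappa_minus (f \o Y) (nu \o Y) phi) kappa ->
   line_of_curvature gam X Y
     (FirstKind.principal_vector (f \o Y) (nu \o Y) phi kappa)
   <->
   \forall t \near (0 : R),
     FirstKind.cusp_directional_torsion (f \o Y) phi (X (gam t)) = 0)
  /\
  (second_kind Sigma f nu p gam ->
   forall (U V : set 'rV[R]_2) (X Y : 'rV[R]_2 -> 'rV[R]_2) (eps : R -> R)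
     (phi : 'rV[R]_2 -> 'rV[R]_3) (kappa : 'rV[R]_2 -> R),
   adapted_second Sigma f p U V X Y eps ->
   phi_second V eps (f \o Y) phi ->
   bounded_principal_curvature
     (SecondKind.kappa_plus eps (f \o Y) (nu \o Y) phi)
     (SecondKind.kappa_minus eps (f \o Y) (nu \o Y) phi) kappa ->
   ~ line_of_curvature gam X Y
       (SecondKind.principal_vector eps (f \o Y) (nu \o Y) phi kappa)).
Proof.
move=> R Sigma f nu p gam _ fnu nd sc.
have e1 : vec2 1 0 != 0 :> 'rV[R]_2.
  by apply/eqP => /rowP /(_ 0); rewrite !mxE /= => /eqP; rewrite oner_eq0.
have e2 : vec2 0 1 != 0 :> 'rV[R]_2.
  by apply/eqP => /rowP /(_ 1); rewrite !mxE /= => /eqP; rewrite oner_eq0.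
split.
  move=> _ U V X Y phi kappa [XY ax nul] [sphi _ gphi] bk.
  have gn := front_frontal_on fnu XY; have oV := chart_open XY; have V0 := chart_V0 XY.
  have dphi x : V x -> twice_differentiable phi x by exact: smooth_on_twice.
  have vn0 x : V x -> vcoord x = 0 -> dv (nu \o Y) x != 0.
    by move=> Vx vx; exact: (front_derive_normal_neq0 fnu XY Vx e2 (nul x Vx vx)).
  have c0 : det3 (du (f \o Y) 0) (phi 0) ((nu \o Y) 0) != 0.
    apply: (front_density_factor_neq0 fnu XY
      (h := fun x => det3 (du (f \o Y) x) (phi x) ((nu \o Y) x)) nd).
      have [[_ dg] [dn _] _ _ _] := gn _ V0.
      exact: det3_differentiable (dg _) (dphi _ V0).1 dn.
    by move=> x Vx; rewrite (gphi x Vx) !det3E !mxE; ring.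
  have [Xgam0 curve] := singular_curve_chart XY sc ax.
  (* The equivalence, valid near the origin of the chart, is pulled back to small [t] along
     [X \o gam]. *)
  have pt := Xgam0 _ (first_principal_torsion oV gn dphi gphi V0 vn0 c0 bk).
  split=> H.
    apply: filterS3 curve pt H => t [_ vX tg] ptt /tg Ht; exact/ptt.
  apply: filterS3 curve pt H => t [_ vX tg] ptt Ht; exact/tg/ptt.
move=> _ U V X Y eps phi kappa [XY ax _ eps0 nul] [sphi _ gphi] _ H.
have gn := front_frontal_on fnu XY; have oV := chart_open XY; have V0 := chart_V0 XY.
have dphi x : V x -> twice_differentiable phi x by exact: smooth_on_twice.
have v0 : vcoord (0 : 'rV[R]_2) = 0 by rewrite /vcoord mxE.
have u0 : ucoord (0 : 'rV[R]_2) = 0 by rewrite /ucoord mxE.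
have du0 : du (f \o Y) 0 = 0.
  by have := nul _ V0 v0; rewrite u0 eps0 scale0r addr0.
have un0 : du (nu \o Y) 0 != 0 := front_derive_normal_neq0 fnu XY V0 e1 du0.
have c0 : det3 (phi 0) (dv (f \o Y) 0) ((nu \o Y) 0) != 0.
  apply: (front_density_factor_neq0 fnu XY
    (h := fun x => det3 (phi x) (dv (f \o Y) x) ((nu \o Y) x)) nd).
    have [[_ dg] [dn _] _ _ _] := gn _ V0.
    exact: det3_differentiable (dphi _ V0).1 (dg _) dn.
  (* Replacing [g_u] by [v phi - eps g_v], the second term drops out of the determinant with [g_v],
     so the density is [v] times det(phi, g_v, n). *)
  move=> x Vx; have -> : du (f \o Y) x = vcoord x *: phi x - eps (ucoord x) *: dv (f \o Y) x.
    by rewrite -(gphi x Vx) addrK.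
  by rewrite !det3E !mxE; ring.
have [_ curve] := singular_curve_chart XY sc ax.
have [_ _ tg] := nbhs_singleton curve.
have Xg0 : X (gam 0) = 0 by have [-> _] := sc; have [[]] := XY.
(* The contradiction already arises at [t = 0], where tangency would force the second component to
   vanish. *)
have := nbhs_singleton H; rewrite /= => /tg /eqP; apply/negP.
rewrite Xg0; exact: (second_principal_vector0 oV gn eps0 gphi kappa V0 un0 c0).
Qed.
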